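(* There is a constant $b>0$ such that for any $\epsilon>0$, the size $G(n)$ of the largest subset of $\{1,2,\ldots,n\}$ free of 3-term geometric progressions with integral ratio satisfies \[G(n) = bn\left(1+O\left(\exp\left(-\sqrt{\left(\tfrac{1}{6}-\epsilon\right)\log n \log \log n}\right)\right)\right).\]
   Context: A 3-term geometric progression with integral ratio is a triple $a, ar, ar^2$ with $a$ a positive integer and $r>1$ an integer. A set is free of such progressions if it does not contain all three terms of any such triple. (It was known previously that $G(n)\sim bn$ for an effectively computable constant $b$ with $0.81841\le b\le 0.81922$.) *)

(* Defs.v *)
From mathcomp Require Import all_boot all_order all_algebra.
From mathcomp Require Import all_classical all_reals all_analysis.

Set Implicit Arguments.
Unset Strict Implicit.
Unset Printing Implicit Defensive.

Import Order.TTheory GRing.Theory Num.Theory.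
Import numFieldNormedType.Exports.

Local Open Scope classical_set_scope.

Definition gp3_free (A : set nat) : Prop :=
  forall a r : nat, (0 < a)%N -> (1 < r)%N ->
    ~ [/\ A a, A (a * r)%N & A (a * r ^ 2)%N].

(* Subsets of {1, ..., n} are encoded as sets over 'I_n.+1 = {0, ..., n} not
   containing 0. *)
Definition gp3_free_max (n : nat) : nat :=
  \max_(A : {set 'I_n.+1} |
          (ord0 \notin A) && `[< gp3_free [set val i | i in [set` A]] >]) #|A|.

(* Main.v *)
Require Import Defs.
From mathcomp Require Import all_boot all_order all_algebra.
From mathcomp Require Import all_classical all_reals all_analysis.
From mathcomp Require Import zify ring lra.

(* Only ratios all of whose primes are at most k matter, up to an error n/k: a
   progression whose ratio has a prime factor p > k ends in a multiple of p^2,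
   and there are at most n/k multiples of such squares below n. Writing every
   integer as (k-smooth) * (k-rough), the problem restricted to k-smooth ratios
   splits over the rough parts t into independent problems on the k-smooth
   numbers up to n/t. The optimum of the latter grows by unit jumps at certain
   smooth numbers s, so the total is the sum over the jumps s of the number of
   k-rough integers up to n/s. A truncated Buchstab iteration estimates these
   counts when s <= sqrt n, and Rankin's trick bounds the contribution of
   s > sqrt n. Hence for every M >= n the ratio G(M)/M is within 2/k plus those
   two errors of a constant depending only on k and n; with
   ln k ~ sqrt(ln n * ln ln n / 6) everything is O(1/k), so that G(n)/n converges
   at this rate. Chebyshev-type input is limited to the bound
   sum_{p <= k} (ln p)/p <= 2 ln k, read off the factorisation of k!. *)

Set Implicit Arguments.
Unset Strict Implicit.
Unset Printing Implicit Defensive.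

Import Order.TTheory GRing.Theory Num.Theory.
Import numFieldNormedType.Exports.

Local Open Scope classical_set_scope.
Local Open Scope nat_scope.

(** * Reduction to smooth ratios *)

Lemma gp3_free_sub (A B : set nat) : A `<=` B -> gp3_free B -> gp3_free A.
Proof.
move=> AB FB a r a0 r1 [A1 A2 A3].
by apply: (FB a r a0 r1); split; apply: AB.
Qed.

(** [leq 1] gives the original problem and [smooth k] the subproblems. Positivity is left to [P]:
    both predicates reject 0. *)
Definition gmax (P : pred nat) (N : nat) : nat :=
  \max_(A : {set 'I_N.+1} |
     [forall i in A, P i] && `[< gp3_free [set val i | i in [set` A]] >]) #|A|.

Lemma gp3_free_maxE n : gp3_free_max n = gmax (leq 1) n.
Proof.
apply: eq_bigl => A; congr (_ && _).
apply/idP/forall_inP => [A0 i iA|A0].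
  by rewrite lt0n; apply: contra A0 => /eqP i0; rewrite (_ : ord0 = i) //; apply: val_inj.
by apply/negP => /A0.
Qed.

(** Together with [gmax_witness], this replaces finite sets of ordinals by duplicate-free sequences
    of naturals. *)
Lemma leq_gmax (P : pred nat) N (s : seq nat) : uniq s ->
  {in s, forall i, P i && (i <= N)} -> gp3_free [set` s] -> size s <= gmax P N.
Proof.
move=> us sP sF; pose A := [set i : 'I_N.+1 | val i \in s]%SET.
have mA i : (i \in A) = (val i \in s) by rewrite inE.
have sA : perm_eq s [seq val i | i <- enum A].
  apply: uniq_perm => // [|x]; first by rewrite map_inj_uniq ?enum_uniq//; exact: val_inj.
  apply/idP/mapP => [xs|[i]]; last by rewrite mem_enum mA => ? ->.
  have /andP[_ xN] := sP x xs.
  by exists (Ordinal (xN : x < N.+1)) => //; rewrite mem_enum mA.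
have -> : size s = #|A| by rewrite (perm_size sA) size_map cardE.
apply: leq_bigmax_cond; apply/andP; split.
  by apply/forall_inP => i; rewrite mA => /sP /andP[].
apply/asboolP; apply: gp3_free_sub sF => _ /= [i + <-].
by rewrite /= mA.
Qed.

Lemma gmax_witness (P : pred nat) N : exists s : seq nat, [/\ uniq s,
  {in s, forall i, P i && (i <= N)}, gp3_free [set` s] & size s = gmax P N].
Proof.
have [|A /andP[/forall_inP AP /asboolP AF] EA] := @eq_bigmax_cond {set 'I_N.+1}
  [pred A : {set 'I_N.+1} | [forall i in A, P i] && `[< gp3_free [set val i | i in [set` A]] >]]
  (fun A => #|A|).
  apply/card_gt0P; exists (finset.set0); rewrite !inE; apply/andP; split.
    by apply/forall_inP => i; rewrite inE.
  by apply/asboolP => a r _ _ [[i]]; rewrite /= inE.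
exists [seq val i | i <- enum A]; split.
- by rewrite map_inj_uniq ?enum_uniq//; exact: val_inj.
- move=> _ /mapP[i iA ->]; rewrite mem_enum in iA.
  by rewrite AP//= -ltnS ltn_ord.
- apply: gp3_free_sub AF => x /= /mapP[i iA ->]; exists i => //=.
  by rewrite -mem_enum.
- by rewrite size_map -cardE; exact: esym EA.
Qed.

Lemma gmax_mono (P : pred nat) N : gmax P N <= gmax P N.+1.
Proof.
have [s [us sP sF <-]] := gmax_witness P N.
apply: leq_gmax => // i /sP /andP[-> iN] /=; exact: leqW.
Qed.

Lemma gmaxS_le (P : pred nat) N : gmax P N.+1 <= gmax P N + P N.+1.
Proof.
have [s [us sP sF <-]] := gmax_witness P N.+1.
have -> : size s = size [seq i <- s | i <= N] + count (pred1 N.+1) s.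
  rewrite size_filter -(count_predC (fun i => i <= N)); congr (_ + _).
  by apply: eq_in_count => i /sP /andP[_ iN] /=; lia.
apply: leq_add.
  apply: leq_gmax => [|i|]; first exact: filter_uniq.
    by rewrite mem_filter => /andP[-> /sP /andP[->]].
  by apply: gp3_free_sub sF => x /=; rewrite mem_filter => /andP[].
rewrite (count_uniq_mem _ us); case: (boolP (_ \in s)) => // /sP /andP[-> _] //.
Qed.

Lemma gmax0 (P : pred nat) : ~~ P 0 -> gmax P 0 = 0.
Proof.
move=> P0; have [s [us sP sF <-]] := gmax_witness P 0.
case: s us sP sF => //= x s _ sP _.
by have /andP[] := sP x (mem_head _ _); rewrite leqn0 => + /eqP x0; rewrite x0 (negbTE P0).
Qed.

(** Truncated subtraction loses nothing, by [gmax_mono]. Since removing one element keeps a set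
    free, the value is 0 or 1. *)
Definition jump (P : pred nat) (s : nat) : nat := gmax P s - gmax P s.-1.

Lemma jump_le (P : pred nat) s : jump P s <= P s.
Proof.
case: s => [|s]; first by rewrite /jump subnn.
by rewrite /jump /= leq_subLR gmaxS_le.
Qed.

Lemma gmax_jump (P : pred nat) N : ~~ P 0 ->
  gmax P N = \sum_(1 <= s < N.+1) jump P s.
Proof.
move=> P0; elim: N => [|N IH]; first by rewrite gmax0// big_geq.
by rewrite big_nat_recr //= -IH /jump subnKC// gmax_mono.
Qed.

(** The integers in (n/4, n] work, since there [a * r ^ 2 >= 4 * a > n]. This bound later makes the
    limit density positive. *)
Lemma gp3_free_quarter n : n - n %/ 4 <= gp3_free_max n.
Proof.
rewrite gp3_free_maxE -(size_iota (n %/ 4).+1 (n - n %/ 4)).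
apply: leq_gmax => [|i|a r a0 r1 []]; first exact: iota_uniq.
  rewrite mem_iota; lia.
rewrite /= !mem_iota => /andP[a1 _] _ /andP[_].
have : 2 ^ 2 <= r ^ 2 by rewrite leq_exp2r.
nia.
Qed.

Definition smooth (k : nat) : pred nat := pnat [pred p | p <= k].
Definition rough (k : nat) : pred nat := pnat [pred p | p <= k]^'.

(** Sort an optimal set by the rough part [t] of its elements. Multiplication by [t] preserves
    progressions, so each class divided by [t] is a free set of smooth numbers. *)
Lemma gp3_free_max_le k n :
  gp3_free_max n <= \sum_(1 <= t < n.+1 | rough k t) gmax (smooth k) (n %/ t).
Proof.
pose pi : nat_pred := [pred p | p <= k].
rewrite gp3_free_maxE; have [s [us sP sF <-]] := gmax_witness (leq 1) n.
have -> : size s = \sum_(i <- s) \sum_(1 <= t < n.+1 | rough k t) (t == i`_pi^').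
  rewrite -sum1_size; apply: eq_big_seq => i /sP /andP[i0 iN].
  rewrite (big_rem i`_pi^') /=; last first.
    rewrite mem_index_iota part_gt0 /= ltnS (leq_trans _ iN)// dvdn_leq//.
    exact: dvdn_part.
  rewrite eqxx /rough /= part_pnat/= big1_seq ?addn0// => t.
  rewrite mem_rem_uniq ?iota_uniq// inE => /andP[_ /andP[/negbTE/= ->]] //.
rewrite exchange_big /= [leqLHS]big_nat_cond [leqRHS]big_nat_cond; apply: leq_sum => t /andP[/andP[t0 tn] rt].
have -> : \sum_(i <- s) (t == i`_pi^') = size [seq i`_pi | i <- s & t == i`_pi^'].
  by rewrite size_map size_filter -sum1_count [RHS]big_mkcond; apply: eq_bigr => i _; case: eqP.
have sK i : i \in [seq i <- s | t == i`_pi^'] -> i`_pi * t = i.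
  rewrite mem_filter => /andP[/eqP -> /sP /andP[i0 _]]; exact: partnC.
apply: leq_gmax => [|_ /mapP[i iis ->]|].
- rewrite map_inj_in_uniq ?filter_uniq// => i j iis jis eij.
  by rewrite -(sK i)// -(sK j)// eij.
- rewrite /smooth /= part_pnat /= leq_divRL// sK//.
  by move: iis; rewrite mem_filter => /andP[_ /sP /andP[]].
- move=> a r a0 r1 [/mapP[x xs ex] /mapP[y ys ey] /mapP[z zs ez]].
  apply: (sF (a * t) r) => //; first by rewrite muln_gt0 a0.
  split => /=.
  + by rewrite ex sK//; move: xs; rewrite mem_filter => /andP[].
  + by rewrite mulnAC ey sK//; move: ys; rewrite mem_filter => /andP[].
  + by rewrite mulnAC ez sK//; move: zs; rewrite mem_filter => /andP[].
Qed.

(** Conversely, glue together the sets [t * B (n %/ t)] with [B] optimal, then discard every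
    multiple of a square [p ^ 2] with [p > k]. What remains is free. *)
Lemma gp3_free_max_ge k n :
  \sum_(1 <= t < n.+1 | rough k t) gmax (smooth k) (n %/ t) <=
  gp3_free_max n + \sum_(k.+1 <= p < n.+1) n %/ p ^ 2.
Proof.
pose pi : nat_pred := [pred p | p <= k].
have [B HB] := boolp.choice (gmax_witness (smooth k)).
pose good m := m`_pi \in B (n %/ m`_pi^').
pose bad m := has (fun p => p ^ 2 %| m) (index_iota k.+1 n.+1).
apply: (@leq_trans (\sum_(1 <= m < n.+1) good m)).
  have -> : \sum_(1 <= m < n.+1) good m =
      \sum_(1 <= m < n.+1) \sum_(1 <= t < n.+1 | rough k t)
        ((t == m`_pi^') && (m`_pi \in B (n %/ t))).
    apply: eq_big_nat => m /andP[m0]; rewrite ltnS => mn.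
    rewrite (big_rem m`_pi^') /=; last first.
      rewrite mem_index_iota part_gt0 /= ltnS (leq_trans _ mn)// dvdn_leq//.
      exact: dvdn_part.
    rewrite eqxx /rough /= part_pnat/= big1_seq ?addn0// => t.
    by rewrite mem_rem_uniq ?iota_uniq// inE => /andP[_ /andP[/negbTE/= ->]].
  rewrite exchange_big /= [leqLHS]big_nat_cond [leqRHS]big_nat_cond; apply: leq_sum => t /andP[/andP[t0 tn] rt].
  have [uB BP _ <-] := HB (n %/ t).
  rewrite (_ : \sum_(_ <- _) _ = count (fun m => (t == m`_pi^') && (m`_pi \in B (n %/ t)))
    (index_iota 1 n.+1)); last first.
    by rewrite -sum1_count [RHS]big_mkcond; apply: eq_bigr => i _; case: ifP.
  rewrite -size_filter -(size_map (muln^~ t)); apply: uniq_leq_size.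
    by rewrite map_inj_uniq// => x y /eqP; rewrite eqn_pmul2r// => /eqP.
  move=> _ /mapP[b bB ->]; have /andP[sb bn] := BP b bB.
  have b0 : 0 < b by case/andP: sb.
  rewrite mem_filter mem_index_iota ltnS muln_gt0 b0 t0 -leq_divRL// bn !andbT.
  rewrite !partnM// (part_pnat_id sb) (part_pnat_id rt) (part_p'nat rt) muln1 bB andbT.
  by rewrite part_p'nat ?mul1n// pnatNK.
apply: (@leq_trans (\sum_(1 <= m < n.+1) (good m && ~~ bad m) +
    \sum_(1 <= m < n.+1) bad m)).
  by rewrite -big_split; apply: leq_sum => m _; case: (good m); case: (bad m).
apply: leq_add; last first.
  have -> : \sum_(k.+1 <= p < n.+1) n %/ p ^ 2 =
      \sum_(k.+1 <= p < n.+1) \sum_(1 <= m < n.+1) (p ^ 2 %| m).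
    by apply: eq_bigr => p _; rewrite divn_count_dvd.
  rewrite exchange_big /=; apply: leq_sum => m _.
  rewrite /bad; case: hasP => // -[p pin pm].
  by rewrite (big_rem p)//= pm.
rewrite gp3_free_maxE.
rewrite (_ : \sum_(_ <= _ < _) _ = count (fun m => good m && ~~ bad m)
  (index_iota 1 n.+1)); last first.
  by rewrite -sum1_count [RHS]big_mkcond; apply: eq_bigr => i _; case: ifP.
rewrite -size_filter; apply: leq_gmax => [|i|a r a0 r1 []].
- by rewrite filter_uniq// iota_uniq.
- by rewrite mem_filter mem_index_iota ltnS => /andP[].
rewrite /= !mem_filter !mem_index_iota.
move=> /andP[/andP[ga _] _] /andP[/andP[gar _] _] /andP[/andP[gar2 bar2] /andP[ar2p ar2n]].
have r0 : 0 < r by exact: ltnW.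
(* A prime [p > k] dividing [r] would make [a * r ^ 2] a multiple of [p ^ 2], hence discarded. *)
have sr : pi.-nat r.
  apply/pnatP => // p pp pr; rewrite !inE leqNgt; apply: contra bar2 => kp.
  apply/hasP; exists p.
    rewrite mem_index_iota kp (leq_ltn_trans _ ar2n)// (leq_trans (dvdn_leq r0 pr))//.
    by rewrite expnS expn1 mulnA leq_pmull// muln_gt0 a0.
  by rewrite dvdn_mull// dvdn_exp2r.
have sr2 : pi.-nat (r ^ 2) by rewrite pnatX sr.
have r20 : 0 < r ^ 2 by rewrite expn_gt0 r0.
(* A smooth ratio leaves the rough part unchanged, so the smooth parts of the three terms form a
   progression inside a single [B]. *)
have [_ _ BF _] := HB (n %/ a`_pi^').
apply: (BF a`_pi r) => //; split => //=.
- by move: gar; rewrite /good !partnM// (part_pnat_id sr) (@part_p'nat _ r) ?muln1// pnatNK.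
- by move: gar2; rewrite /good !(partnM _ a0 r20) (part_pnat_id sr2) (@part_p'nat _ (r ^ 2)) ?muln1// pnatNK.
Qed.

(** * Jumps and the truncated sieve *)

Lemma big_nat_dvd (V : nmodType) (F : nat -> V) d n : 0 < d ->
  (\sum_(1 <= t < n.+1 | (d %| t)%N) F t = \sum_(1 <= u < (n %/ d).+1) F (d * u)%N)%R.
Proof.
move=> d0; elim: n => [|n IH]; first by rewrite div0n !big_geq.
rewrite big_mkcond big_nat_recr//= -big_mkcond IH divnS//.
case: ifPn => dn; last by rewrite add0n GRing.addr0.
rewrite add1n [RHS]big_nat_recr//=; congr (GRing.add _ (F _)).
by have := divnS n d0; rewrite dn add1n => <-; rewrite mulnC divnK.
Qed.

(** Both sides count the pairs [(s, t)] with [s * t <= n], weighted by [jump P s] and [Q t]. *)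
Lemma sum_gmax_jump (P Q : pred nat) n : ~~ P 0 ->
  \sum_(1 <= t < n.+1 | Q t) gmax P (n %/ t) =
  \sum_(1 <= s < n.+1) jump P s * \sum_(1 <= t < (n %/ s).+1) Q t.
Proof.
move=> P0.
transitivity (\sum_(1 <= t < n.+1) \sum_(1 <= s < n.+1)
    if s * t <= n then jump P s * Q t else 0).
  rewrite big_mkcond; apply: eq_big_nat => t /andP[t0 tn].
  case: (Q t); last by rewrite big1// => s _; rewrite muln0; case: ifP.
  rewrite gmax_jump// (@big_nat_widen _ _ _ _ _ n.+1) ?ltnS ?leq_div// big_mkcond /=.
  by apply: eq_bigr => s _; rewrite ltnS leq_divRL// muln1.
rewrite exchange_big; apply: eq_big_nat => s /andP[s0 sn].
rewrite [in RHS](@big_nat_widen _ _ _ _ _ n.+1) ?ltnS ?leq_div// [in RHS]big_mkcond /=.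
rewrite big_distrr /=; apply: eq_bigr => t _.
by rewrite ltnS leq_divRL// mulnC; case: ifP; rewrite ?muln0.
Qed.

Definition sift (l : seq nat) (y : nat) : nat :=
  \sum_(1 <= t < y.+1) all (fun p => ~~ (p %| t)) l.

Lemma sift_le l y : sift l y <= y.
Proof.
apply: (@leq_trans (\sum_(1 <= t < y.+1) 1)); first by apply: leq_sum => t _; case: all.
by rewrite sum_nat_const_nat muln1 subn1.
Qed.

(** Among the integers that survive [l], the multiples [p * u] correspond to the [u] that survive
    [l], because [p] differs from the primes in [l]. *)
Lemma sift_Buchstab p l y : prime p -> all prime l -> p \notin l ->
  sift (p :: l) y + sift l (y %/ p) = sift l y.
Proof.
move=> pp pl npl.
have -> : sift l (y %/ p) = \sum_(1 <= t < y.+1 | p %| t) all (fun p => ~~ (p %| t)) l.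
  rewrite (@big_nat_dvd nat)//; last exact: prime_gt0.
  apply: eq_bigr => u _; congr (nat_of_bool _); apply: eq_in_all => q ql.
  have pq := allP pl q ql.
  rewrite Euclid_dvdM// (dvdn_prime2 pq pp).
  case: (eqVneq q p) => //= qp.
  by move: npl; rewrite -qp ql.
rewrite /sift [X in _ + X]big_mkcond -big_split; apply: eq_bigr => t _ /=.
by case: (p %| t) => //=; rewrite addn0.
Qed.

Definition primes_upto k := [seq p <- index_iota 2 k.+1 | prime p].

Lemma mem_primes_upto k p : (p \in primes_upto k) = prime p && (p <= k).
Proof.
rewrite mem_filter mem_index_iota ltnS; case: (boolP (prime p)) => //= pp.
by rewrite prime_gt1.
Qed.

Lemma rough_sift k y : \sum_(1 <= t < y.+1) rough k t = sift (primes_upto k) y.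
Proof.
apply: eq_big_nat => t /andP[t0 _]; congr (nat_of_bool _).
apply/pnatP/allP => // H p; first rewrite mem_primes_upto => /andP[pp pk].
  by apply/negP => /(H p pp); rewrite !inE pk.
move=> pp pt; rewrite !inE; apply/negP => pk.
by have := H p; rewrite mem_primes_upto pp pk => /(_ isT); rewrite pt.
Qed.

Local Open Scope ring_scope.

Lemma ler_divn (R : realType) (n d : nat) : (n %/ d)%:R <= n%:R / d%:R :> R.
Proof.
case: d => [|d]; first by rewrite divn0 invr0 mulr0.
by rewrite ler_pdivlMr// -natrM ler_nat leq_trunc_div.
Qed.

Lemma ltr_divn (R : realType) (n d : nat) : (0 < d)%N -> n%:R / d%:R < (n %/ d)%:R + 1 :> R.
Proof.
move=> d0; rewrite ltr_pdivrMr ?ltr0n// natr1 -natrM ltr_nat.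
by rewrite ltn_ceil.
Qed.

Lemma prod_1subV_itv (R : realType) (l : seq nat) : all prime l ->
  0 <= \prod_(p <- l) (1 - p%:R^-1 : R) <= 1.
Proof.
move=> pl; rewrite big_seq; elim/big_rec: _ => [|p x pin /andP[x0 x1]]; first by rewrite ler01 lexx.
have p1 : (p%:R^-1 : R) <= 1.
  by rewrite invf_le1 ?ler1n ?ltr0n prime_gt0//; exact: (allP pl).
have p0 : (0 : R) <= p%:R^-1 by rewrite invr_ge0.
apply/andP; split; first by rewrite mulr_ge0// subr_ge0.
by rewrite mulr_ile1// ?subr_ge0// gerBl.
Qed.

(* Iterating Buchstab's identity and stopping after [m] steps, with the trivial
   bound on the sifted sets that remain. *)
Lemma sift_approx (R : realType) (l : seq nat) (m n d : nat) :
  uniq l -> all prime l -> (0 < d)%N ->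
  `|(sift l (n %/ d))%:R - n%:R / d%:R * \prod_(p <- l) (1 - p%:R^-1)| <=
  (size l).+1%:R ^+ m +
    n%:R / d%:R * ((\sum_(p <- l) p%:R^-1) ^+ m / m`!%:R) :> R.
Proof.
elim: l m d => [|p l IH] m d ul pl d0.
  rewrite !big_nil mulr1 expr1n /sift sum_nat_const_nat muln1 subn1/=.
  rewrite ler_wpDr// ?mulr_ge0 ?exprn_ge0//.
  have := ltr_divn R n d0; have := ler_divn R n d; rewrite ler_norml; lra.
case: m => [|m].
  (* With no step left, both compared quantities lie in [0, n/d]. *)
  rewrite !expr0 fact0 divr1 mulr1.
  have nd0 : (0 : R) <= n%:R / d%:R by rewrite mulr_ge0.
  have /andP[P0 P1] := prod_1subV_itv R pl.
  have S1 : (sift (p :: l) (n %/ d))%:R <= n%:R / d%:R :> R.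
    apply: le_trans (ler_divn _ _ _); rewrite ler_nat.
    exact: sift_le.
  have S0 : (0 : R) <= (sift (p :: l) (n %/ d))%:R by [].
  have X0 := mulr_ge0 nd0 P0.
  have X1 := ler_wpM2l nd0 P1.
  rewrite mulr1 in X1.
  rewrite ler_norml; lra.
move: ul pl => /= /andP[npl ul] /andP[pp pl].
have p0 : (0 < p)%N by exact: prime_gt0.
have pR0 : (0 : R) < p%:R by rewrite ltr0n.
have := sift_Buchstab (n %/ d) pp pl npl; rewrite -divnMA => H.
have -> : (sift (p :: l) (n %/ d))%:R =
    (sift l (n %/ d))%:R - (sift l (n %/ (d * p)))%:R :> R.
  by rewrite -H natrD addrK.
rewrite !big_cons; set P := \prod_(_ <- _) _; set S := \sum_(_ <- _) _.
have -> : n%:R / d%:R * ((1 - p%:R^-1) * P) =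
   n%:R / d%:R * P - n%:R / (d * p)%:R * P :> R.
  by rewrite natrM invfM; ring.
rewrite [X in `|X|](_ : _ =
   ((sift l (n %/ d))%:R - n%:R / d%:R * P) -
   ((sift l (n %/ (d * p)))%:R - n%:R / (d * p)%:R * P)); last by ring.
apply: (le_trans (ler_normB _ _)).
apply: (le_trans (lerD (IH m.+1 d ul pl d0) (IH m (d * p)%N ul pl _))).
  by rewrite muln_gt0 d0.
rewrite addrACA -/S; apply: lerD.
  rewrite exprS [X in _ <= X]exprS.
  apply: (@le_trans _ _ ((size l).+2%:R * (size l).+1%:R ^+ m)).
    by rewrite -[X in _ <= X * _]natr1 mulrDl mul1r.
  by rewrite ler_wpM2l// lerXn2r ?nnegrE// ler_nat.
have -> : n%:R / (d * p)%:R * (S ^+ m / m`!%:R) = n%:R / d%:R * (p%:R^-1 * (S ^+ m / m`!%:R)).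
  by rewrite natrM invfM; ring.
rewrite -mulrDr ler_wpM2l ?mulr_ge0 ?invr_ge0//.
have S0 : 0 <= S by rewrite sumr_ge0.
have q0 : (0 : R) <= p%:R^-1 by rewrite invr_ge0.
have mf : (0 : R) < m.+1`!%:R by rewrite ltr0n fact_gt0.
have mf' : (0 : R) < m`!%:R by rewrite ltr0n fact_gt0.
rewrite ler_pdivlMr// mulrDl divfK ?gt_eqF//.
have -> : p%:R^-1 * (S ^+ m / m`!%:R) * m.+1`!%:R = p%:R^-1 * S ^+ m *+ m.+1 :> R.
  by rewrite factS natrM -mulr_natr; field; rewrite gt_eqF//= gt_eqF.
(* With [q] the inverse of [p], it remains to see that (q + S)^(m+1) is at least the sum of the two
   terms of its binomial expansion of degree 0 and 1 in q. *)
elim: m {IH mf mf'} => [|m IH]; first by rewrite !expr1 expr0 mulr1 mulr1n addrC.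
rewrite [leRHS]exprS.
apply: le_trans (ler_wpM2l _ IH); last by rewrite addr_ge0.
rewrite mulrDr !mulrDl -!mulrnAr -!exprS.
have -> : S * (p%:R^-1 * (S ^+ m *+ m.+1)) = p%:R^-1 * (S ^+ m.+1 *+ m.+1).
  by rewrite exprS mulrnAr; ring.
rewrite [S ^+ m.+1 *+ m.+2]mulrS mulrDr.
have : 0 <= p%:R^-1 * (p%:R^-1 * (S ^+ m *+ m.+1)).
  by rewrite !mulr_ge0// mulrn_wge0// exprn_ge0.
lra.
Qed.

(** * Sums over smooth numbers *)

Definition sump (R : realType) k : R := \sum_(p <- primes_upto k) p%:R^-1.

Lemma big_primes_upto (V : nmodType) (F : nat -> V) k :
  \sum_(p <- primes_upto k) F p = \sum_(2 <= p < k.+1 | prime p) F p.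
Proof. by rewrite big_filter. Qed.

Lemma primes_uptoS k : primes_upto k.+1 =
  if prime k.+1 then rcons (primes_upto k) k.+1 else primes_upto k.
Proof.
case: k => [//|k]; rewrite /primes_upto /index_iota.
rewrite (_ : k.+3 - 2 = (k.+2 - 2) + 1)%N; last by lia.
rewrite iotaD filter_cat /= (_ : 2 + (k.+2 - 2) = k.+2)%N; last by lia.
by case: ifP; rewrite ?cats1 ?cats0.
Qed.

Lemma smoothS k s : (0 < s)%N ->
  smooth k s = smooth k.+1 s && ~~ (prime k.+1 && (k.+1 %| s)%N).
Proof.
move=> s0; apply/pnatP/andP => // [H|[/pnatP H n1] p pp ps].
  split; first by apply/pnatP => // p pp ps; have := H p pp ps; rewrite !inE => /leqW.
  by apply/negP => /andP[pp ps]; have := H _ pp ps; rewrite !inE ltnn.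
have := H s0 p pp ps; rewrite !inE leq_eqVlt ltnS => /orP[/eqP pk|//].
by move: n1; rewrite -pk pp ps.
Qed.

Lemma sum_nat_ler (R : realType) (F : nat -> R) (P : pred nat) a m n : (forall i, 0 <= F i) -> (m <= n)%N ->
  \sum_(a <= i < m | P i) F i <= \sum_(a <= i < n | P i) F i.
Proof.
move=> F0 mn; rewrite (big_nat_widen _ _ _ _ _ mn).
rewrite big_mkcond [leRHS]big_mkcond; apply: ler_sum => i _.
by case: (P i) => //=; case: ifP.
Qed.

(** A truncated Euler product, by induction on [k]. At a prime [q = k.+1] the multiples of [q]
    contribute at most [f q * S], so the whole sum satisfies [S <= T + f q * S], with [T] the sum
    for [k]; no geometric series is expanded. *)
Lemma sum_smooth_le (R : realType) (f : nat -> R) (k N : nat) :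
  f 1%N = 1 -> (forall a b, (0 < a)%N -> (0 < b)%N -> f (a * b)%N = f a * f b) ->
  (forall a, 0 <= f a) -> (forall p, prime p -> f p < 1) ->
  \sum_(1 <= s < N.+1 | smooth k s) f s <= \prod_(p <- primes_upto k) (1 - f p)^-1.
Proof.
move=> f1 fM f0 fp; elim: k => [|k IH].
  rewrite big_nil.
  have sm0 s : (0 < s)%N -> smooth 0 s -> s = 1%N.
    move=> s0 /pnatP H; case: (ltngtP s 1) => // [|/pdivP[p pp ps]]; first lia.
    by have := H s0 p pp ps; rewrite !inE leqn0 => /eqP p0; rewrite p0 in pp.
  case: N => [|N]; first by rewrite big_geq.
  have S0 : \sum_(2 <= s < N.+2 | smooth 0 s) f s = 0.
    rewrite big_nat_cond big1// => s /andP[/andP[s1 _] ss].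
    by have := sm0 s (ltnW s1) ss; lia.
  by rewrite big_ltn_cond// S0; case: (smooth 0 1); rewrite ?addr0 ?f1.
rewrite primes_uptoS; case: ifPn => pk; last first.
  apply: le_trans IH; rewrite [leLHS]big_nat_cond [leRHS]big_nat_cond.
  rewrite (@eq_bigl _ _ _ _ _ _ (fun s => (0 < s < N.+1)%N && smooth k s))// => s.
  by case: (ltnP 0 s) => //= s0; rewrite (smoothS k s0) (negbTE pk) andbT.
set S := \sum_(_ <= _ < _ | _) _.
have SE : S = \sum_(1 <= s < N.+1 | smooth k s) f s +
    \sum_(1 <= s < N.+1 | (k.+1 %| s)%N) (if smooth k.+1 s then f s else 0).
  rewrite /S big_mkcond [X in _ = X + _]big_mkcond [X in _ = _ + X]big_mkcond.
  rewrite -big_split; apply: eq_big_nat => s /andP[s0 _] /=.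
  rewrite (smoothS k s0) pk /=.
  by case: (smooth k.+1 s) => /=; case: (_ %| _)%N => /=; rewrite ?addr0 ?add0r.
have : S <= \sum_(1 <= s < N.+1 | smooth k s) f s + f k.+1 * S.
  rewrite {1}SE lerD2l big_nat_dvd// /S mulr_sumr.
  have NN : ((N %/ k.+1).+1 <= N.+1)%N by rewrite ltnS leq_div.
  apply: le_trans (sum_nat_ler _ _ _ NN); last by move=> s; rewrite mulr_ge0.
  rewrite [leRHS]big_mkcond /=; apply: ler_sum_nat => s /andP[s0 _].
  rewrite fM// /smooth pnatM.
  by case: (pnat _ s) => /=; [case: ifP => _; rewrite ?mulr_ge0|rewrite andbF].
have q1 : 0 < 1 - f k.+1 by rewrite subr_gt0 fp.
move=> H; rewrite -cats1 big_cat big_seq1 /= ler_pdivlMr//; move: IH H.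
set T := \sum_(_ <= _ < _ | smooth k _) _; set P := \prod_(_ <- _) _; nra.
Qed.

(** For [x] in [0, 3/4], (1 - x)(1 + 4x) = 1 + x(3 - 4x) >= 1. *)
Lemma inv_1sub_le_expR (R : realType) (x : R) : 0 <= x -> x <= 3 / 4 ->
  (1 - x)^-1 <= expR (4 * x).
Proof.
move=> x0 x1; have := expR_ge1Dx (4 * x); rewrite invf_ple ?posrE ?expR_gt0//; last by lra.
move=> H; apply: (@le_trans _ _ (1 + 4 * x)^-1).
  by rewrite lef_pV2// posrE ?expR_gt0//; lra.
rewrite invf_ple ?posrE; [|lra|lra].
rewrite -[leLHS]mul1r ler_pdivrMr; [nra|lra].
Qed.

(* Rankin's trick with exponent [lam / ln k], for which
   [p ^ (lam / ln k) <= expR lam] at every prime [p <= k]. *)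
Lemma rankin (R : realType) (k N : nat) (lam : R) : (1 < k)%N -> 0 <= lam -> lam <= ln k%:R / 2 ->
  \sum_(1 <= s < N.+1 | smooth k s) expR (lam / ln k%:R * ln s%:R) / s%:R <=
  expR (4 * (expR lam * sump R k)).
Proof.
move=> k1 lam0 lamk; set sig := lam / ln k%:R.
have lk0 : 0 < ln k%:R :> R by rewrite ln_gt0// ltr1n.
have sig0 : 0 <= sig by rewrite divr_ge0// ltW.
have sig2 : sig <= 1 / 2 by rewrite ler_pdivrMr//; lra.
(* As [sig <= 1 / 2], the quotient is at most the inverse square root of 2, which is below 3/4. *)
have f2 p : (1 < p)%N -> expR (sig * ln p%:R) / p%:R <= 3 / 4 :> R.
  move=> p1; have pR : (0 : R) < p%:R by rewrite ltr0n ltnW.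
  have lp0 : 0 <= ln p%:R :> R by rewrite ln_ge0// ler1n ltnW.
  apply: (@le_trans _ _ (expR (- (ln 2 / 2)))).
    rewrite -[X in _ / X]lnK ?posrE// -expRB ler_expR.
    have : ln 2 <= ln p%:R :> R by rewrite ler_ln ?posrE// ler_nat.
    nra.
  rewrite -(@ler_pXn2r _ 2) ?nnegrE ?expR_ge0//.
  by rewrite -expRM_natl mulrN mulrC divfK// expRN lnK ?posrE//; lra.
apply: (@le_trans _ _ (\prod_(p <- primes_upto k) (1 - expR (sig * ln p%:R) / p%:R)^-1)).
  apply: (@sum_smooth_le R (fun s => expR (sig * ln s%:R) / s%:R)).
  - by rewrite ln1 mulr0 expR0 divr1.
  - move=> a b a0 b0; rewrite natrM lnM ?posrE ?ltr0n// mulrDr expRD invfM; ring.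
  - by move=> a; rewrite divr_ge0// expR_ge0.
  - by move=> p pp; apply: le_lt_trans (f2 p (prime_gt1 pp)) _; lra.
rewrite /sump !mulr_sumr expR_sum big_seq [leRHS]big_seq; apply: ler_prod => p.
rewrite mem_primes_upto => /andP[pp pk]; have p1 := prime_gt1 pp.
have h := f2 p p1.
have h0 : 0 <= expR (sig * ln p%:R) / p%:R :> R by rewrite divr_ge0// expR_ge0.
rewrite invr_ge0 subr_ge0 (le_trans h) /=; last by lra.
apply: (le_trans (inv_1sub_le_expR h0 h)).
rewrite ler_expR ler_pM2l// ler_wpM2r// ler_expR.
rewrite /sig mulrAC ler_pdivrMr// ler_wpM2l// ler_ln ?posrE ?ltr0n ?(ltnW p1) ?(ltnW k1)//.
by rewrite ler_nat.
Qed.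

(** * Sums over primes *)

Lemma ln_prod (R : realType) (I : Type) (r : seq I) (P : pred I) (F : I -> R) :
  (forall i, P i -> 0 < F i) -> ln (\prod_(i <- r | P i) F i) = \sum_(i <- r | P i) ln (F i).
Proof.
move=> F0; suff [] : 0 < \prod_(i <- r | P i) F i /\
  ln (\prod_(i <- r | P i) F i) = \sum_(i <- r | P i) ln (F i) by [].
elim/big_rec2: _ => [|i y x Pi [x0 <-]]; first by rewrite ltr01 ln1.
by rewrite mulr_gt0 ?F0// lnM ?posrE ?F0.
Qed.

Lemma ln_fact_le (R : realType) n : ln n`!%:R <= n%:R * ln n%:R :> R.
Proof.
rewrite fact_prod natr_prod big_nat ln_prod => [|i /andP[i0 _]]; last by rewrite ltr0n.
apply: (@le_trans _ _ (\sum_(1 <= i < n.+1) ln n%:R)).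
  rewrite -big_nat; apply: ler_sum_nat => i /andP[i0 i1].
  by rewrite ler_ln ?posrE ?ltr0n ?ler_nat// (leq_trans i0).
by rewrite sumr_const_nat subn1 mulr_natl.
Qed.

(** Legendre's formula for the exponent of [p] in the factorial, keeping only its first term
    [n %/ p]. *)
Lemma ln_fact_ge (R : realType) n :
  \sum_(p <- primes_upto n) (n %/ p)%:R * ln p%:R <= ln n`!%:R :> R.
Proof.
have nf := fact_geq n.
rewrite -[in leRHS](partnT (fact_gt0 n)) (widen_partn _ (leqnn _)) natr_prod.
have p0 p : (0 < p ^ logn p n`!)%N by rewrite expn_gt0; case: p => // [|p]; rewrite ?logn0.
rewrite ln_prod => [|p _]; last by rewrite ltr0n.
rewrite big_primes_upto (@big_nat_widenl _ _ _ 2 0)// (@big_nat_widen _ _ _ _ _ n`!.+1) ?ltnS//.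
rewrite big_mkcond; apply: ler_sum => p _ /=.
case: ifP => [/andP[/andP[pp p2] pn]|_]; last by rewrite ln_ge0// ler1n.
rewrite natrX lnXn ?ltr0n ?(ltnW p2)// -[leRHS]mulr_natl ler_wpM2r ?ln_ge0 ?ler1n ?(ltnW p2)//.
rewrite ler_nat logn_fact// big_ltn ?expn1 ?leq_addr//.
by apply: leq_trans pn; rewrite ltnS ltnW.
Qed.

(** For [p <= n] the floor [n %/ p] is at least 1, so n/p is at most twice that floor; then compare
    the two bounds on the factorial. *)
Lemma sum_ln_div_le (R : realType) n :
  \sum_(p <- primes_upto n) ln p%:R / p%:R <= 2 * ln n%:R :> R.
Proof.
case: n => [|n]; first by rewrite ln0// mulr0 big_primes_upto big_geq.
have n0 : (0 : R) < n.+1%:R by [].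
rewrite -(ler_pM2l n0) mulrCA mulr_sumr.
apply: (@le_trans _ _ (2 * ln n.+1`!%:R)); last by rewrite ler_pM2l// ln_fact_le.
apply: (@le_trans _ _ (2 * \sum_(p <- primes_upto n.+1) (n.+1 %/ p)%:R * ln p%:R)); last first.
  by rewrite ler_pM2l// ln_fact_ge.
rewrite mulr_sumr big_seq [leRHS]big_seq; apply: ler_sum => p.
rewrite mem_primes_upto => /andP[pp pn]; have p0 := prime_gt0 pp.
rewrite [leLHS](_ : _ = n.+1%:R / p%:R * ln p%:R); last by ring.
rewrite mulrA ler_wpM2r ?ln_ge0 ?ler1n//.
have := ltr_divn R n.+1 p0.
have : (1 : R) <= (n.+1 %/ p)%:R by rewrite ler1n divn_gt0.
lra.
Qed.

Lemma ler_sump (R : realType) k l : (k <= l)%N -> sump R k <= sump R l.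
Proof. by move=> kl; rewrite /sump !big_primes_upto sum_nat_ler// => i; rewrite invr_ge0. Qed.

Lemma sump_ge0 (R : realType) k : 0 <= sump R k.
Proof. by rewrite /sump sumr_ge0// => i _; rewrite invr_ge0. Qed.

(* Each block [2 ^ 2 ^ j < p <= 2 ^ 2 ^ j.+1] contributes at most 4, so that the
   sum is [O(ln (ln k))]. *)
Lemma sump_le (R : realType) j : sump R (2 ^ 2 ^ j) <= 4 * j%:R + 1.
Proof.
elim: j => [|j IH].
  rewrite mulr0 add0r /sump big_primes_upto big_ltn_cond//= big_geq//.
  by rewrite addr0; lra.
set K := (2 ^ 2 ^ j)%N in IH; have K2 : (2 ^ 2 ^ j.+1 = K ^ 2)%N by rewrite expnS mulnC expnM.
have K1 : (1 < K)%N by rewrite -[1%N](expn0 2) ltn_exp2l// expn_gt0.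
have KK : (K <= K ^ 2)%N by rewrite expnS expn1 leq_pmulr// ltnW.
have KR : (0 : R) < K%:R by rewrite ltr0n ltnW.
have lK : 0 < ln K%:R :> R by rewrite ln_gt0// ltr1n.
rewrite K2 /sump big_primes_upto (@big_cat_nat _ _ _ K.+1)/= ?ltnS ?(ltnW K1)//.
rewrite -big_primes_upto -/(sump R K).
rewrite [leRHS](_ : _ = 4 * j%:R + 1 + 4); last by rewrite -addn1 natrD; ring.
rewrite lerD//.
(* On the block [K < p <= K ^ 2], [ln K <= ln p], so the block sum times [ln K] is at most
   [2 * ln (K ^ 2) = 4 * ln K]. *)
rewrite -(ler_pM2r lK) mulr_suml.
apply: (@le_trans _ _ (2 * ln (K ^ 2)%:R)); last by rewrite natrX lnXn//; lra.
apply: le_trans (sum_ln_div_le _ _).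
rewrite big_primes_upto [leRHS](@big_cat_nat _ _ _ K.+1)/= ?ltnS ?(ltnW K1)//.
rewrite ler_wpDl//.
  rewrite big_nat_cond sumr_ge0// => p /andP[/andP[p2 _] _].
  by rewrite divr_ge0// ln_ge0// ler1n ltnW.
rewrite big_nat_cond [leRHS]big_nat_cond; apply: ler_sum => p /andP[/andP[pK _] _].
have p0 : (0 : R) < p%:R by rewrite ltr0n; lia.
by rewrite mulrC ler_wpM2r ?invr_ge0 ?(ltW p0)// ler_ln ?posrE// ler_nat ltnW.
Qed.

Lemma sum_inv_sqr_le (R : realType) k n : (0 < k)%N ->
  \sum_(k.+1 <= p < n.+1) (p%:R ^+ 2)^-1 <= k%:R^-1 :> R.
Proof.
move=> k0; have kR : (0 : R) < k%:R by rewrite ltr0n.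
have [nk|/subnKC <-] := leqP n k; first by rewrite big_geq ?invr_ge0// ltnS.
set d := (n - _)%N; rewrite addSnnS; move: d.+1 => {n}d.
(* The sharper bound telescopes, since 1/p^2 <= 1/(p - 1) - 1/p. *)
suff : \sum_(k.+1 <= p < (k + d).+1) (p%:R ^+ 2)^-1 <= k%:R^-1 - (k + d)%:R^-1 :> R.
  by move/le_trans; apply; rewrite gerBl invr_ge0.
elim: d => [|d IH]; first by rewrite addn0 big_geq// subrr.
rewrite addnS big_nat_recr /=; last by rewrite ltnS leq_addr.
apply: (le_trans (lerD IH (lexx _))).
have x0 : (0 : R) < (k + d)%:R by rewrite ltr0n addn_gt0 k0.
rewrite -natr1; set x := _%:R in x0 *.
rewrite -addrA lerD2l -subr_ge0.
rewrite [leRHS](_ : _ = x^-1 / (x + 1) ^+ 2); last by field; rewrite !gt_eqF//; lra.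
by rewrite divr_ge0 ?invr_ge0 ?exprn_ge0//; lra.
Qed.

(** * The explicit estimate *)

Lemma gp3_free_max_sift (R : realType) k n : (0 < k)%N ->
  `|(gp3_free_max n)%:R - \sum_(1 <= s < n.+1)
      (jump (smooth k) s)%:R * (sift (primes_upto k) (n %/ s))%:R| <= n%:R / k%:R :> R.
Proof.
move=> k0.
have -> : \sum_(1 <= s < n.+1) (jump (smooth k) s)%:R * (sift (primes_upto k) (n %/ s))%:R =
    (\sum_(1 <= t < n.+1 | rough k t) gmax (smooth k) (n %/ t))%N%:R :> R.
  rewrite sum_gmax_jump// natr_sum; apply: eq_bigr => s _.
  by rewrite natrM rough_sift.
have := gp3_free_max_le k n; have := gp3_free_max_ge k n.
rewrite -!(ler_nat R) natrD.
have : (\sum_(k.+1 <= p < n.+1) n %/ p ^ 2)%N%:R <= n%:R / k%:R :> R.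
  apply: le_trans (ler_wpM2l (ler0n R n) (sum_inv_sqr_le R n k0)).
  rewrite natr_sum mulr_sumr; apply: ler_sum => p _.
  by rewrite -natrX ler_divn.
by rewrite ler_norml; lra.
Qed.

(** One term of the exponential series at [x * expR lam]. Taking the [lam] of Rankin's trick gives
    the sieve remainder the same shape as the tail. *)
Lemma exprn_div_fact_le (R : realType) (x lam : R) m : 0 <= x ->
  x ^+ m / m`!%:R <= expR (x * expR lam - m%:R * lam).
Proof.
move=> x0; have y0 : 0 <= x * expR lam by rewrite mulr_ge0// expR_ge0.
rewrite expRB expRM_natl ler_pdivlMr ?exprn_gt0 ?expR_gt0// mulrAC -exprMn.
case: m => [|m]; first by rewrite expr0 fact0 divr1 -expR0 ler_expR.
by apply: le_trans (expR_ge1Dxn m y0); rewrite ler_wpDl.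
Qed.

Lemma size_primes_upto k : (0 < k)%N -> (size (primes_upto k) < k)%N.
Proof.
move=> k0; rewrite size_filter (leq_ltn_trans (count_size _ _))// size_iota; lia.
Qed.

(** The three errors are the counting error of the sieve for [s <= N], its truncation error there,
    and the trivial bound for [s > N]. *)
Lemma sift_sum_approx (R : realType) (k m n N : nat) (lam y : R) :
  (1 < k)%N -> 0 <= lam -> lam <= ln k%:R / 2 -> (N <= n)%N -> 0 < y -> y <= N.+1%:R ->
  `|\sum_(1 <= s < n.+1) (jump (smooth k) s)%:R * (sift (primes_upto k) (n %/ s))%:R
    - n%:R * (\prod_(p <- primes_upto k) (1 - p%:R^-1) *
              \sum_(1 <= s < N.+1) (jump (smooth k) s)%:R / s%:R)| <=
  N%:R * k%:R ^+ m
  + n%:R * expR (5 * (expR lam * sump R k) - m%:R * lam)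
  + n%:R * expR (4 * (expR lam * sump R k) - lam / ln k%:R * ln y).
Proof.
move=> k1 lam0 lamk Nn y0 yN.
set P := \prod_(_ <- _) _; set S := sump R k; set T := expR lam * S.
have lk0 : 0 < ln k%:R :> R by rewrite ln_gt0// ltr1n.
set sig := lam / ln k%:R.
have sig0 : 0 <= sig by rewrite divr_ge0// ltW.
have S0 : 0 <= S := sump_ge0 R k.
have j1 s : (jump (smooth k) s)%:R <= (smooth k s)%:R :> R by rewrite ler_nat jump_le.
have W M : \sum_(1 <= s < M.+1) (smooth k s)%:R * (expR (sig * ln s%:R) / s%:R) <= expR (4 * T).
  apply: le_trans (rankin M k1 lam0 lamk); rewrite [leRHS]big_mkcond.
  by apply: ler_sum => s _; case: (smooth k s); rewrite ?mul1r ?mul0r.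
rewrite (@big_cat_nat _ _ _ N.+1)//= ?ltnS// addrAC.
apply: (le_trans (ler_normD _ _)); apply: lerD.
  rewrite mulrA mulr_sumr -sumrB.
  apply: (le_trans (ler_norm_sum _ _ _)).
  (* Of [5 * T], one [T] comes from truncating the sieve and [4 * T] from the sum over smooth [s].
     Weights [expR (sig * ln s%:R) >= 1] are inserted so that [W] applies. *)
  have -> : expR (5 * T - m%:R * lam) = expR (T - m%:R * lam) * expR (4 * T).
    by rewrite -expRD; congr expR; ring.
  set d := expR (T - _).
  apply: (@le_trans _ _ (\sum_(1 <= s < N.+1) (k%:R ^+ m +
      n%:R * d * ((smooth k s)%:R * (expR (sig * ln s%:R) / s%:R))))); last first.
    rewrite big_split/= sumr_const_nat subn1 /= -[_ ^+ _ *+ _]mulr_natl lerD2l -mulr_sumr [leRHS]mulrA.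
    by rewrite ler_wpM2l ?mulr_ge0 ?expR_ge0.
  apply: ler_sum_nat => s /andP[s0 _].
  have sR : (0 : R) < s%:R by rewrite ltr0n.
  rewrite [X in `|X|](_ : _ = (jump (smooth k) s)%:R *
      ((sift (primes_upto k) (n %/ s))%:R - n%:R / s%:R * P)); last by ring.
  rewrite normrM ger0_norm//.
  have up : uniq (primes_upto k) by rewrite filter_uniq// iota_uniq.
  have ap : all prime (primes_upto k) by exact: filter_all.
  have H := sift_approx R m n up ap s0; rewrite -/P -[\sum_(_ <- _) _]/S in H.
  apply: (le_trans (ler_pM _ _ (j1 s) H)) => //.
  case: (smooth k s); rewrite ?mul0r ?mul1r; last first.
    by rewrite mulr0 addr0 exprn_ge0.
  apply: lerD.
    by rewrite lerXn2r ?nnegrE// ler_nat size_primes_upto// ltnW.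
  rewrite -!mulrA ler_wpM2l//.
  apply: (@le_trans _ _ (s%:R^-1 * d)).
    by rewrite ler_wpM2l ?invr_ge0 ?(ltW sR)// /d /T [expR lam * _]mulrC exprn_div_fact_le.
  rewrite mulrC ler_wpM2l ?expR_ge0// ler_peMl ?invr_ge0 ?(ltW sR)//.
  by rewrite -[leLHS]expR0 ler_expR mulr_ge0// mulr_ge0 ?invr_ge0 ?(ltW lk0)// ln_ge0// ler1n.
rewrite ger0_norm ?sumr_ge0//.
have -> : expR (4 * T - sig * ln y) = expR (- (sig * ln y)) * expR (4 * T).
  by rewrite -expRD addrC.
set d := expR (- _).
(* Rankin's weight (s/y)^sig is at least 1, since [y <= N.+1 <= s]. *)
apply: (@le_trans _ _ (n%:R * d * \sum_(N.+1 <= s < n.+1) (smooth k s)%:R * (expR (sig * ln s%:R) / s%:R))); last first.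
  rewrite mulrA ler_wpM2l ?mulr_ge0 ?expR_ge0//; apply: le_trans (W n).
  rewrite [leRHS](@big_cat_nat _ _ _ N.+1)//= ?ltnS// ler_wpDl// sumr_ge0//.
rewrite mulr_sumr; apply: ler_sum_nat => s /andP[Ns sn].
have sR : (0 : R) < s%:R by rewrite ltr0n (leq_trans _ Ns).
apply: (@le_trans _ _ ((smooth k s)%:R * (n%:R / s%:R))).
  by rewrite ler_pM// (le_trans _ (ler_divn _ _ _))// ler_nat sift_le.
rewrite [leRHS](_ : _ = (smooth k s)%:R * (n%:R * (d * expR (sig * ln s%:R)) / s%:R)); last by ring.
rewrite ler_wpM2l// ler_wpM2r ?invr_ge0 ?(ltW sR)// ler_peMr//.
rewrite -expRD -[leLHS]expR0 ler_expR addrC -mulrBr mulr_ge0// subr_ge0.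
by rewrite ler_ln ?posrE// (le_trans yN)// ler_nat.
Qed.

(* Truncating at [y = sqrt n], with [m] about [v - 1] steps of the sieve, where
   [sqrt n = k ^ v]. *)
Lemma gp3_free_max_approx (R : realType) (k n : nat) (lam : R) :
  (1 < k)%N -> 0 <= lam -> lam <= ln k%:R / 2 -> (0 < n)%N -> 2 * ln k%:R <= ln n%:R :> R ->
  exists B : R, forall M, (n <= M)%N -> `|(gp3_free_max M)%:R / M%:R - B| <=
    2 / k%:R + 2 * expR (5 * (expR lam * sump R k) - lam * (ln n%:R / (2 * ln k%:R) - 2)).
Proof.
move=> k1 lam0 lamk n0 kn.
have lk0 : 0 < ln k%:R :> R by rewrite ln_gt0// ltr1n.
set v := ln n%:R / _; set T := expR lam * _.
have v1 : 1 <= v by rewrite ler_pdivlMr ?mulr_gt0//; lra.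
have nR : (0 : R) < n%:R by rewrite ltr0n.
set y : R := expR (ln n%:R / 2).
have y0 : 0 < y := expR_gt0 _.
have yy : y * y = n%:R by rewrite -expRD -splitr lnK.
set N := Num.truncn y.
have Ny : N%:R <= y by rewrite truncn_le ltW.
have yN : y <= N.+1%:R by rewrite ltW// truncnS_gt.
have [m mv vm] : exists2 m, m.+1%:R <= v & v < m.+2%:R.
  have : (0 < Num.truncn v)%N by rewrite truncn_gt0.
  case E : (Num.truncn v) => [//|m] _; exists m; rewrite -E ?truncnS_gt// truncn_le; lra.
(* Only [k] and [N] enter, and [N] comes from [n], so one constant serves every [M >= n]. *)
exists (\prod_(p <- primes_upto k) (1 - p%:R^-1) *
              \sum_(1 <= s < N.+1) (jump (smooth k) s)%:R / s%:R) => M nM.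
set B := \prod_(_ <- _) _ * _.
have NM : (N <= M)%N.
  apply: leq_trans nM; rewrite -(ler_nat R) -yy (le_trans Ny)// ler_peMl ?(ltW y0)//.
  by rewrite -[leLHS]expR0 ler_expR divr_ge0// ln_ge0// ler1n.
have MR : (0 : R) < M%:R by rewrite (lt_le_trans nR)// ler_nat.
have kR : (0 : R) < k%:R by rewrite ltr0n ltnW.
have H1 := gp3_free_max_sift R M (ltnW k1).
have H2 := @sift_sum_approx R k m M N lam y k1 lam0 lamk NM y0 yN.
rewrite -/T -/B in H2.
(* Both [N] and k^(m+1) are at most k^v = [y], the square root of [n]. *)
have H3 : N%:R * k%:R ^+ m <= M%:R / k%:R :> R.
  rewrite ler_pdivlMr// -mulrA -exprSr.
  apply: (@le_trans _ _ n%:R); last by rewrite ler_nat.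
  rewrite -yy ler_pM ?exprn_ge0// /y -[X in X ^+ _](@lnK R) ?posrE// -expRM_natl ler_expR.
  rewrite -ler_pdivlMr// (le_trans mv)// /v.
  by rewrite invfM mulrA.
have H4 : expR (5 * T - m%:R * lam) <= expR (5 * T - lam * (v - 2)).
  by rewrite ler_expR lerD2l lerN2 mulrC ler_wpM2r//; move: vm; rewrite -addn2 natrD; lra.
have T0 : 0 <= T by rewrite mulr_ge0 ?expR_ge0 ?sump_ge0.
have H5 : expR (4 * T - lam / ln k%:R * ln y) <= expR (5 * T - lam * (v - 2)).
  rewrite ler_expR /y expRK.
  have -> : lam / ln k%:R * (ln n%:R / 2) = lam * v by rewrite /v; field; rewrite gt_eqF.
  by rewrite mulrBr; lra.
have -> : (gp3_free_max M)%:R / M%:R - B = ((gp3_free_max M)%:R - M%:R * B) / M%:R.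
  by field; rewrite gt_eqF.
rewrite normrM normfV (gtr0_norm MR) ler_pdivrMr// mulrDl.
set X := \sum_(_ <= _ < _) _ in H1 H2.
rewrite (_ : _ - _ = ((gp3_free_max M)%:R - X) + (X - M%:R * B)); last by ring.
apply: (le_trans (ler_normD _ _)); apply: (le_trans (lerD H1 H2)).
have := ler_wpM2l (ltW MR) H4; have := ler_wpM2l (ltW MR) H5.
rewrite [2 / k%:R * _]mulrAC -mulrA [2 * expR _ * _]mulrAC -mulrA mulrAC; lra.
Qed.

(** * Choice of parameters and the limit *)

Lemma expR_half_le2 (R : realType) : expR (1 / 2) <= 2 :> R.
Proof.
have := expR_ge1Dx (- (1 / 2) : R); rewrite expRN => H.
have e0 := expR_gt0 (1 / 2 : R).
by rewrite -(invrK (expR _)) invf_ple ?posrE ?invr_gt0//; lra.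
Qed.

Lemma ln2_bounds (R : realType) : 1 / 2 <= ln (2 : R) <= 1.
Proof.
apply/andP; split; rewrite -ler_expR lnK ?posrE//; first exact: expR_half_le2.
by apply: le_trans (expR_ge1Dx _); lra.
Qed.

Lemma sump_lnln (R : realType) (k : nat) (x : R) : 1 <= x -> ln k%:R <= expR x ->
  (* The exponent [j] makes 2^j * ln 2 >= expR (x + 1) / 2 >= expR x, using [ln 2 >= 1 / 2]; then 4j
     + 1 <= 4(2x + 3) + 1. *)
  sump R k <= 8 * x + 13.
Proof.
move=> x1 kx; set j := (Num.truncn (2 * x + 2)).+1.
have j1 : 2 * x + 2 <= j%:R by rewrite ltW// truncnS_gt.
have j2 : j%:R <= 2 * x + 3.
  have : (Num.truncn (2 * x + 2))%:R <= 2 * x + 2 by rewrite truncn_le; lra.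
  by rewrite /j -[_.+1%:R]natr1; lra.
suff kj : (k <= 2 ^ 2 ^ j)%N.
  by apply: (le_trans (ler_sump R kj)); apply: (le_trans (sump_le R j)); lra.
case: k kx => // k kx; rewrite -(ler_nat R).
have /andP[l2 _] := ln2_bounds R.
rewrite -[leLHS]lnK ?posrE ?ltr0n// -[leRHS]lnK ?posrE ?ltr0n ?expn_gt0//.
rewrite ler_expR natrX lnXn// -[_ *+ (2 ^ j)]mulr_natl natrX (le_trans kx)//.
rewrite -[X in X ^+ j]lnK ?posrE// -expRM_natl.
apply: (@le_trans _ _ (expR (x + 1) * (1 / 2))).
  by rewrite expRD; have := expR_ge1Dx (1 : R); have := expR_gt0 x; nra.
by rewrite ler_pM ?expR_ge0// ler_expR; nra.
Qed.

(* With [X = ln (ln n) / 10] and [kap] the square root, take [k] the floor of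
   [expR kap] and [lam = 4 * X]. Since [kap ^ 2 = ln n * ln (ln n) / 6], the term
   [lam * ln n / (2 * kap)] equals [6 / 5 * kap]; the spare [kap / 5] absorbs the
   loss [5 * expR lam * sump R k = O(X * expR (4 * X))] because
   [kap >= expR (5 * X)]. The threshold 2000 is merely large enough for this. *)
Lemma gp3_free_max_approx_lnln (R : realType) (n : nat) :
  2000 <= ln (ln n%:R) :> R ->
  exists B : R, forall M, (n <= M)%N -> `|(gp3_free_max M)%:R / M%:R - B| <=
    6 * expR (- Num.sqrt (1 / 6 * ln n%:R * ln (ln n%:R))).
Proof.
set L : R := ln n%:R; set LL : R := ln L => LL2000.
have L0 : 0 < L by rewrite ltNge; apply/negP => /(@ln0 R); rewrite -/LL => LL0; lra.
have n0 : (0 < n)%N by rewrite lt0n; apply/eqP => nz; move: L0; rewrite /L nz ln0// ltxx.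
have [X X200 LLX] : exists2 X : R, 200 <= X & LL = 10 * X.
  by exists (LL / 10); [lra|field].
have LE : L = expR (10 * X) by rewrite -LLX lnK.
set kap := Num.sqrt _.
have kap2 : kap * kap = 1 / 6 * L * LL by rewrite -expr2 sqr_sqrtr// !mulr_ge0//; lra.
have kapX : expR (5 * X) <= kap.
  rewrite -(@ler_pXn2r _ 2) ?nnegrE ?expR_ge0 ?sqrtr_ge0// expr2 expr2 kap2 -expRD.
  by rewrite (_ : 5 * X + 5 * X = 10 * X) -?LE; [nra|ring].
have kap0 : 0 < kap by apply: lt_le_trans kapX; rewrite expR_gt0.
have e5X : 1 + 5 * X <= expR (5 * X) := expR_ge1Dx _.
have kapL : 2 * kap <= L.
  rewrite -(@ler_pXn2r _ 2) ?nnegrE ?(ltW L0) ?mulr_ge0 ?(ltW kap0)//.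
  have : LL < L by exact: ln_sublinear.
  have -> : (2 * kap) ^+ 2 = 4 * (kap * kap) by ring.
  by rewrite kap2; nra.
set k := Num.truncn (expR kap).
have k1 : k%:R <= expR kap by rewrite truncn_le expR_ge0.
have k2 : expR kap < k.+1%:R by exact: truncnS_gt.
have kgt1 : (1 < k)%N.
  by rewrite truncn_gt_nat; have := expR_ge1Dx kap; lra.
have kR : (1 : R) < k%:R by rewrite ltr1n.
have kR0 : (0 : R) < k%:R by lra.
have ekk : expR kap <= 2 * k%:R by move: k2; rewrite -natr1; lra.
have lk1 : ln k%:R <= kap by rewrite -ler_expR lnK.
have lk2 : kap - 1 <= ln k%:R.
  have /andP[_ l2] := ln2_bounds R.
  suff : kap <= ln 2 + ln k%:R by lra.
  by rewrite -lnM ?posrE// -ler_expR lnK// posrE mulr_gt0.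
have lk0 : 0 < ln k%:R :> R by lra.
have lam0 : 0 <= 4 * X by lra.
have kn : 2 * ln k%:R <= L by lra.
have lamk : 4 * X <= ln k%:R / 2.
  have X5 : 0 <= 5 * X by lra.
  by have := expR_ge1Dxn 1 X5; rewrite expr2 (_ : 2`! = 2)%N//; nra.
have [B HB] := @gp3_free_max_approx R k n (4 * X) kgt1 lam0 lamk n0 kn.
exists B => M nM; apply: (le_trans (HB M nM)); rewrite -/L.
have -> : 6 * expR (- kap) = 4 / expR kap + 2 * expR (- kap) by rewrite expRN; ring.
apply: lerD.
  rewrite ler_pdivrMr// mulrAC ler_pdivlMr ?expR_gt0//; lra.
rewrite ler_pM2l// ler_expR.
have S1 : sump R k <= 90 * X.
  apply: (le_trans (@sump_lnln R k LL _ _)); [lra| |lra].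
  by rewrite LLX -LE; lra.
have v1 : 6 / 5 * kap <= 4 * X * (L / (2 * ln k%:R)).
  rewrite mulrA ler_pdivlMr ?mulr_gt0//.
  apply: (@le_trans _ _ (12 / 5 * (kap * kap))); first by nra.
  by rewrite kap2 LLX; lra.
have T1 : expR (4 * X) * sump R k <= expR (4 * X) * (90 * X) by rewrite ler_wpM2l ?expR_ge0.
have e4 : 1 <= expR (4 * X) by rewrite -[leLHS]expR0 ler_expR.
have eX : X * X * X / 6 <= expR X.
  have X0 : 0 <= X by lra.
  by have := expR_ge1Dxn 2 X0; rewrite (_ : 3`! = 6)%N// !exprS expr0 mulr1 mulrA; lra.
have e5 : expR (5 * X) = expR (4 * X) * expR X by rewrite -expRD; congr expR; ring.
(* From [X >= 200], X^3/6 >= (40000/6) X. In the end the loss is at most 458 X expR (4X), which is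
   below [kap / 5]. *)
have f1 : 6666 * X <= expR X by nra.
have f2 : expR (4 * X) * (6666 * X) <= kap by apply: le_trans kapX; rewrite e5 ler_wpM2l ?expR_ge0.
have f3 : X <= expR (4 * X) * X by rewrite ler_peMl// (le_trans _ X200).
rewrite mulrBr; nra.
Qed.

Lemma lnln_ge (R : realType) (y : R) :
  exists N, forall n, (N <= n)%N -> y <= ln (ln n%:R).
Proof.
exists (Num.truncn (expR (expR y))).+1 => n Nn.
have nE : expR (expR y) <= n%:R.
  by rewrite ltW// (lt_le_trans (truncnS_gt _))// ler_nat.
have lE : expR y <= ln n%:R.
  by rewrite -ler_expR lnK// posrE (lt_le_trans _ nE)// expR_gt0.
by rewrite -ler_expR lnK// posrE (lt_le_trans _ lE)// expR_gt0.
Qed.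

(** The constants [B] vary with [n], but their existence makes the ratios Cauchy. Both the limit and
    the ratio at [n] are within [6 * d] of [B], whence 12. *)
Lemma gp3_free_max_cvg (R : realType) :
  exists2 b : R, 3 / 4 <= b & forall n : nat, 2000 <= ln (ln n%:R) :> R ->
    `|(gp3_free_max n)%:R / n%:R - b| <=
      12 * expR (- Num.sqrt (1 / 6 * ln n%:R * ln (ln n%:R))).
Proof.
pose u (n : nat) : R := (gp3_free_max n)%:R / n%:R.
have uc : cvg (u @ \oo).
  apply: cauchy_cvg; apply: cauchy_exP => e e0; rewrite /fmapE -ball_normE /ball_.
  (* With [kap >= LL / 3], this choice gives e(1 + kap) > 20/3 > 6, so [6 * expR (- kap) < e]. *)
  have [n /(_ n (leqnn n)) nE] := lnln_ge (2000 + 20 / e).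
  have e1 : 0 < 20 / e by rewrite divr_gt0.
  have n1 : 2000 <= ln (ln n%:R) :> R by lra.
  have [B HB] := gp3_free_max_approx_lnln n1.
  exists B, n => // M nM /=; rewrite distrC; apply: le_lt_trans (HB M nM) _.
  set L : R := ln n%:R; set LL : R := ln L in n1 nE *.
  have L0 : 0 < L by rewrite ltNge; apply/negP => /(@ln0 R); rewrite -/LL => LL0; lra.
  have LLL : LL < L by exact: ln_sublinear.
  set kap := Num.sqrt _.
  have kapL : LL / 3 <= kap.
    by rewrite -(@ler_pXn2r _ 2) ?nnegrE ?sqrtr_ge0// ?sqr_sqrtr; nra.
  have : 1 + kap <= expR kap := expR_ge1Dx _.
  rewrite expRN ltr_pdivrMr ?expR_gt0// => H.
  have e2 : e * (20 / e) = 20 by rewrite mulrCA divff ?gt_eqF// mulr1.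
  apply: (@lt_le_trans _ _ (e * (20 / e / 3))); first by rewrite mulrA e2; lra.
  by rewrite (ler_pM2l e0); lra.
exists (lim (u @ \oo)).
  apply: limr_ge => //; exists 1%N => // n /= n0.
  rewrite ler_pdivlMr ?ltr0n//.
  apply: (@le_trans _ _ (n - n %/ 4)%N%:R); last by rewrite ler_nat gp3_free_quarter.
  rewrite natrB ?leq_div//; have := ler_divn R n 4; lra.
move=> n n1; have [B HB] := gp3_free_max_approx_lnln n1.
set d := expR _ in HB *.
have l1 : B - 6 * d <= lim (u @ \oo).
  apply: limr_ge => //; exists n => // M /= nM.
  by have := HB M nM; rewrite -/(u M) ler_norml => /andP[]; lra.
have l2 : lim (u @ \oo) <= B + 6 * d.
  apply: limr_le => //; exists n => // M /= nM.
  by have := HB M nM; rewrite -/(u M) ler_norml => /andP[]; lra.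
have := HB n (leqnn n); rewrite -/(u n) !ler_norml => /andP[]; lra.
Qed.

Theorem theorem2p7 (R : realType) :
  exists2 b : R, 0 < b &
    forall eps : R, 0 < eps ->
      exists2 E : nat -> R,
        E =O_\oo (fun n : nat =>
          expR (- Num.sqrt ((1 / 6 - eps) * ln n%:R * ln (ln n%:R)))) &
        forall n : nat, (gp3_free_max n)%:R = b * n%:R * (1 + E n).
Proof.
have [b b34 Hb] := gp3_free_max_cvg R.
have b0 : 0 < b by lra.
exists b => // eps eps0.
exists (fun n => (gp3_free_max n)%:R / n%:R / b - 1); last first.
  move=> n; rewrite addrC subrK; case: n => [|n].
    (* At 0 the quotient takes a default value, but both sides of the identity vanish. *)
    by rewrite mulr0 mul0r gp3_free_maxE gmax0.
  by field; rewrite gt_eqF//= pnatr_eq0.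
have [N HN] := lnln_ge (2000 : R).
apply/eqO_exP; exists (12 / b); first by rewrite divr_gt0.
exists N => // n /= Nn; have n1 := HN n Nn.
rewrite (gtr0_norm (expR_gt0 _)).
rewrite (_ : _ - 1 = ((gp3_free_max n)%:R / n%:R - b) / b); last by rewrite mulrBl divff ?gt_eqF.
rewrite normrM normfV (gtr0_norm b0) ler_pdivrMr// mulrAC divfK ?gt_eqF//.
(* Subtracting [eps] only shrinks the root; once the radicand is negative, [Num.sqrt] is 0 and
   monotonicity persists. *)
apply: (le_trans (Hb n n1)); rewrite ler_pM2l// ler_expR lerN2.
have L0 : 0 < ln n%:R :> R.
  by rewrite ltNge; apply/negP => /(@ln0 R) LL0; move: n1; rewrite LL0; lra.
rewrite ler_wsqrtr// ler_wpM2r//; first by lra.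
by rewrite ler_wpM2r ?(ltW L0)//; lra.
Qed.
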